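(* Let $M\subset\mathbb{R}^2$ be a connected, simply connected open set and let $X:M\to\mathbb{R}^4_1$ be a minimal spacelike graph of first type $X(x,y)=(A(x,y),x,y,B(x,y))$ or of second type $X(x,y)=(x,A(x,y),B(x,y),y)$, with coefficients $E,F,G$ and $W=\sqrt{EG-F^2}$. Fix $z_0\in M$. Then the functions $$u(x,y)=x+\int_{z_0}^{(x,y)}\frac{E\,dx+F\,dy}{W},\qquad v(x,y)=y+\int_{z_0}^{(x,y)}\frac{F\,dx+G\,dy}{W}$$ are well defined on $M$ and satisfy the generalized Cauchy–Riemann equations $$u_y=\frac FE u_x-\frac WE v_x,\qquad v_y=\frac WE u_x+\frac FE v_x,$$ so that $(u,v)$ provide isothermic parameters for $X(M)$.
   Context: $\mathbb{R}^4_1$: $\mathbb{R}^4$ with $\langle (a_0,\dots,a_3),(b_0,\dots,b_3)\rangle=-a_0b_0+a_1b_1+a_2b_2+a_3b_3$. $E=\langle X_x,X_x\rangle$, $F=\langle X_x,X_y\rangle$, $G=\langle X_y,X_y\rangle$. $A,B$ are smooth real functions. Minimal means vanishing mean curvature vector. Isothermic parameters $(u,v)$: the induced metric is $\lambda^2(du^2+dv^2)$. *)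

(* Defs.v *)
From Stdlib Require Import Reals Lra.
From Coquelicot Require Import Coquelicot.
Open Scope R_scope.

Definition px (f : R -> R -> R) (x y : R) : R := Derive (fun t => f t y) x.
Definition py (f : R -> R -> R) (x y : R) : R := Derive (fun t => f x t) y.

Definition unc (f : R -> R -> R) : R * R -> R := fun p => f (fst p) (snd p).

Fixpoint Ck (k : nat) (U : R * R -> Prop) (f : R -> R -> R) : Prop :=
  match k with
  | O => forall p, U p -> continuous (unc f) p
  | S k' => (forall x y, U (x, y) ->
               ex_derive (fun t => f t y) x /\ ex_derive (fun t => f x t) y)
            /\ Ck k' U f /\ Ck k' U (px f) /\ Ck k' U (py f)
  end.

Definition smooth_on (U : R * R -> Prop) (f : R -> R -> R) : Prop :=
  forall k, Ck k U f.

Definition open_R2 (U : R * R -> Prop) : Prop := open U.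

Definition connected_set (U : R * R -> Prop) : Prop :=
  ~ (exists V1 V2 : R * R -> Prop,
        open V1 /\ open V2 /\
        (forall p, U p -> V1 p \/ V2 p) /\
        (forall p, U p -> V1 p -> V2 p -> False) /\
        (exists p, U p /\ V1 p) /\ (exists p, U p /\ V2 p)).

Definition I01 (t : R) : Prop := 0 <= t <= 1.

Definition cont_on_R (D : R -> Prop) (g : R -> R * R) : Prop :=
  forall t, D t -> filterlim g (within D (locally t)) (locally (g t)).

Definition cont_on_R2 (D : R * R -> Prop) (H : R * R -> R * R) : Prop :=
  forall p, D p -> filterlim H (within D (locally p)) (locally (H p)).

Definition square01 (p : R * R) : Prop := I01 (fst p) /\ I01 (snd p).

Definition simply_connected (U : R * R -> Prop) : Prop :=
  forall g : R -> R * R,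
    cont_on_R I01 g -> (forall t, I01 t -> U (g t)) -> g 0 = g 1 ->
    exists H : R * R -> R * R,
      cont_on_R2 square01 H /\
      (forall p, square01 p -> U (H p)) /\
      (forall t, I01 t -> H (0, t) = g t) /\
      (exists c, forall t, I01 t -> H (1, t) = c) /\
      (forall s, I01 s -> H (s, 0) = H (s, 1)).

Definition lor (V W : nat -> R) : R :=
  - V 0%nat * W 0%nat + V 1%nat * W 1%nat + V 2%nat * W 2%nat + V 3%nat * W 3%nat.

Definition Xx (X : nat -> R -> R -> R) x y : nat -> R := fun i => px (X i) x y.
Definition Xy (X : nat -> R -> R -> R) x y : nat -> R := fun i => py (X i) x y.
Definition Xxx (X : nat -> R -> R -> R) x y : nat -> R := fun i => px (px (X i)) x y.
Definition Xxy (X : nat -> R -> R -> R) x y : nat -> R := fun i => py (px (X i)) x y.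
Definition Xyy (X : nat -> R -> R -> R) x y : nat -> R := fun i => py (py (X i)) x y.

Definition EE X x y := lor (Xx X x y) (Xx X x y).
Definition FF X x y := lor (Xx X x y) (Xy X x y).
Definition GG X x y := lor (Xy X x y) (Xy X x y).
Definition WW X x y := sqrt (EE X x y * GG X x y - FF X x y ^ 2).

Definition graph1 (A B : R -> R -> R) : nat -> R -> R -> R :=
  fun i x y => match i with
               | 0%nat => A x y | 1%nat => x | 2%nat => y | _ => B x y end.
Definition graph2 (A B : R -> R -> R) : nat -> R -> R -> R :=
  fun i x y => match i with
               | 0%nat => x | 1%nat => A x y | 2%nat => B x y | _ => y end.

(** Spacelike: the induced metric E dx^2 + 2F dxdy + G dy^2 is positive definite. *)
Definition spacelike_on (U : R * R -> Prop) X : Prop :=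
  forall x y, U (x, y) -> 0 < EE X x y /\ 0 < EE X x y * GG X x y - FF X x y ^ 2.

(** Mean curvature vector (up to the nonzero factor 1/(2(EG-F^2))):
    H is the normal part of g^{ij} X_{ij}, i.e. of  N := G X_xx - 2F X_xy + E X_yy.
    The normal part is N minus its orthogonal projection onto span(X_x, X_y). *)
Definition HH_unnorm X x y : nat -> R :=
  let E := EE X x y in let F := FF X x y in let G := GG X x y in
  let N := fun i => G * Xxx X x y i - 2 * F * Xxy X x y i + E * Xyy X x y i in
  let a := lor N (Xx X x y) in let b := lor N (Xy X x y) in
  let D := E * G - F ^ 2 in
  fun i => N i - ((G * a - F * b) / D * Xx X x y i + (- F * a + E * b) / D * Xy X x y i).

Definition minimal_on (U : R * R -> Prop) X : Prop :=
  forall x y, U (x, y) -> forall i, (i < 4)%nat -> HH_unnorm X x y i = 0.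

(* Main.v *)
Require Import Defs.
From Stdlib Require Import Reals Lra Lia Classical ClassicalEpsilon FunctionalExtensionality.
From Coquelicot Require Import Coquelicot.
Open Scope R_scope.

(* Since x and y are themselves coordinates of X, two components of the mean curvature equation
   have vanishing second derivatives; they force N = G X_xx - 2F X_xy + E X_yy to be orthogonal to
   X_x and X_y. Up to the factor W^3, the curls of (E/W, F/W) and (F/W, G/W) are combinations of
   <N,X_x> and <N,X_y>, so both forms are closed. Exactness on M: integrals along L-shaped paths
   are additive on small boxes, hence summing them over the cells of a fine grid, pulled back by
   a null-homotopy of a loop, shows that the sums along the loop vanish; the potential is then the
   value of the sums along any path from the base point, which exists by connectedness.
   Isothermality is algebra, with lambda^2 = W^2 / (2W + E + G). *)

(** * Local primitives of a closed form *)

(* Integral of P dx + Q dy along the L-shaped path from p to q: first horizontal, then vertical. *)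
Definition line_int (P Q : R -> R -> R) (p q : R * R) : R :=
  RInt (fun s => P s (snd p)) (fst p) (fst q) + RInt (fun t => Q (fst q) t) (snd p) (snd q).

(** [K] is the common value of P_y and Q_x; its joint continuity is what differentiation under the
    integral sign requires. *)
Definition closed_form (M : R * R -> Prop) (P Q : R -> R -> R) : Prop :=
  (forall p, M p -> continuous (unc P) p /\ continuous (unc Q) p) /\
  exists K : R -> R -> R, (forall p, M p -> continuous (unc K) p) /\
    forall x y, M (x, y) ->
      is_derive (fun t => P x t) y (K x y) /\ is_derive (fun t => Q t y) x (K x y).

(** Open squares are the balls of the product uniform structure, and a square contains the L-shaped
    path between any two of its points. *)
Definition box (z : R * R) (r : R) (q : R * R) : Prop :=
  Rabs (fst q - fst z) < r /\ Rabs (snd q - snd z) < r.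

Lemma box_center z r : 0 < r -> box z r z.
Proof. intros Hr; unfold box; rewrite !Rminus_diag, Rabs_R0; auto. Qed.

Lemma open_box (M : R * R -> Prop) z : open M -> M z -> exists r, 0 < r /\ forall q, box z r q -> M q.
Proof.
  intros HM Hz. destruct (HM z Hz) as [eps He].
  exists eps; split; [apply cond_pos|]. intros q [H1 H2]; apply He; split; assumption.
Qed.

Lemma between_Rabs a x y r t : Rabs (x - a) < r -> Rabs (y - a) < r ->
  Rmin x y <= t <= Rmax x y -> Rabs (t - a) < r.
Proof.
  intros Hx Hy Ht. apply Rabs_def2 in Hx, Hy. apply Rabs_def1; revert Ht;
  unfold Rmin, Rmax; destruct (Rle_dec x y); lra.
Qed.

Lemma locally_Rabs a r x : Rabs (x - a) < r -> locally x (fun t => Rabs (t - a) < r).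
Proof.
  intros H. assert (Hd : 0 < r - Rabs (x - a)) by lra.
  exists (mkposreal _ Hd). intros t Ht. change (Rabs (t - x) < r - Rabs (x - a)) in Ht.
  replace (t - a) with ((t - x) + (x - a)) by ring.
  eapply Rle_lt_trans; [apply Rabs_triang|lra].
Qed.

Lemma continuous_slice_x (f : R -> R -> R) x y : continuous (unc f) (x, y) -> continuous (fun t => f t y) x.
Proof.
  intros H. apply (continuous_comp_2 (fun t : R => t) (fun _ => y) f); auto.
  apply continuous_id. apply continuous_const.
Qed.

Lemma continuous_slice_y (f : R -> R -> R) x y : continuous (unc f) (x, y) -> continuous (fun t => f x t) y.
Proof.
  intros H. apply (continuous_comp_2 (fun _ => x) (fun t : R => t) f); auto.
  apply continuous_const. apply continuous_id.
Qed.

(** Along y only the vertical leg varies, and the fundamental theorem gives Q. Along x the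
    horizontal leg gives P(x,b), while the vertical leg gives the integral of Q_x = P_y from b to y,
    that is P(x,y) - P(x,b). *)
Lemma line_int_derive M P Q z r x y : closed_form M P Q -> (forall q, box z r q -> M q) ->
  box z r (x, y) ->
  is_derive (fun t => line_int P Q z (t, y)) x (P x y) /\
  is_derive (fun t => line_int P Q z (x, t)) y (Q x y).
Proof.
  intros [HPQ [K [HK HD]]] HM [Hx Hy]. destruct z as [a b]; unfold line_int; simpl in *.
  assert (Hr : 0 < r) by (eapply Rle_lt_trans; [apply Rabs_pos|exact Hx]).
  assert (Ha : Rabs (a - a) < r) by (rewrite Rminus_diag, Rabs_R0; auto).
  assert (Hb : Rabs (b - b) < r) by (rewrite Rminus_diag, Rabs_R0; auto).
  assert (HM' : forall s t, Rabs (s - a) < r -> Rabs (t - b) < r -> M (s, t))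
    by (intros; apply HM; split; assumption).
  assert (EP : forall s, Rabs (s - a) < r -> ex_RInt (fun s => P s b) a s).
  { intros s Hs. apply (ex_RInt_continuous (V := R_CompleteNormedModule)); intros w Hw.
    apply continuous_slice_x, HPQ, HM'; auto. eapply between_Rabs; [| |apply Hw]; auto. }
  assert (EQ : forall s t, Rabs (s - a) < r -> Rabs (t - b) < r -> ex_RInt (fun t => Q s t) b t).
  { intros s t Hs Ht. apply (ex_RInt_continuous (V := R_CompleteNormedModule)); intros w Hw.
    apply continuous_slice_y, HPQ, HM'; auto. eapply between_Rabs; [| |apply Hw]; auto. }
  split.
  - replace (P x y) with (P x b + (P x y - P x b)) by ring.
    apply (is_derive_plus (K := R_AbsRing) (V := R_NormedModule)).
    + apply (is_derive_RInt (V := R_NormedModule) (fun s => P s b) _ a).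
      * apply filter_imp with (2 := locally_Rabs _ _ _ Hx). intros s Hs.
        apply (RInt_correct (V := R_CompleteNormedModule)), EP, Hs.
      * apply continuous_slice_x, HPQ, HM'; auto.
    + replace (P x y - P x b) with (RInt (fun t => Derive (fun u => Q u t) x) b y).
      * apply is_derive_RInt_param.
        -- apply filter_imp with (2 := locally_Rabs _ _ _ Hx). intros s Hs t Ht.
           eexists. apply HD, HM'; auto. eapply between_Rabs; [| |apply Ht]; auto.
        -- intros t Ht.
           assert (Ht' : Rabs (t - b) < r) by (eapply between_Rabs; [| |apply Ht]; auto).
           (* The rule for parametric integrals asks for joint continuity of the partial derivative
              of Q, which coincides with [K] near this point. *)
           apply continuity_2d_pt_ext_loc with K.
           ++ apply locally_2d_locally.
              destruct (locally_Rabs _ _ _ Hx) as [d1 H1], (locally_Rabs _ _ _ Ht') as [d2 H2].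
              assert (Hd : 0 < Rmin d1 d2) by (apply Rmin_pos; apply cond_pos).
              exists (mkposreal _ Hd). intros [s w] [Hs Hw]. simpl in *.
              symmetry. apply is_derive_unique, HD, HM'.
              ** apply H1. eapply ball_le; [|apply Hs]. apply Rmin_l.
              ** apply H2. eapply ball_le; [|apply Hw]. apply Rmin_r.
           ++ apply continuity_2d_pt_filterlim, (HK (x, t)), HM'; auto.
        -- apply filter_imp with (2 := locally_Rabs _ _ _ Hx). intros s Hs. apply EQ; auto.
      * rewrite (RInt_ext _ (fun t => K x t)).
        -- apply is_RInt_unique. apply (is_RInt_derive (fun t => P x t) (fun t => K x t)).
           ++ intros t Ht. apply HD, HM'; auto. eapply between_Rabs; [| |apply Ht]; auto.
           ++ intros t Ht. apply continuous_slice_y, HK, HM'; auto.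
              eapply between_Rabs; [| |apply Ht]; auto.
        -- intros t Ht. apply is_derive_unique, HD, HM'; auto.
           eapply between_Rabs with (x := b) (y := y); auto; lra.
  - replace (Q x y) with (0 + Q x y) by ring.
    apply (is_derive_plus (K := R_AbsRing) (V := R_NormedModule)).
    + apply (is_derive_const (K := R_AbsRing) (V := R_NormedModule)).
    + apply (is_derive_RInt (V := R_NormedModule) (fun t => Q x t) _ b).
      * apply filter_imp with (2 := locally_Rabs _ _ _ Hy). intros s Hs.
        apply (RInt_correct (V := R_CompleteNormedModule)), EQ; auto.
      * apply continuous_slice_y, HPQ, HM'; auto.
Qed.

Definition additive_on (B : R * R -> Prop) (w : R * R -> R * R -> R) : Prop :=
  forall p q s, B p -> B q -> B s -> w p q + w q s = w p s.

(** By the fundamental theorem on each leg, [line_int P Q p q] is the difference at [q] and [p] of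
    one primitive, the integral from the centre [z]; additivity is then telescoping. *)
Lemma line_int_additive M P Q z r : closed_form M P Q -> (forall q, box z r q -> M q) ->
  additive_on (box z r) (line_int P Q).
Proof.
  intros HC HM.
  assert (H : forall p q, box z r p -> box z r q ->
    line_int P Q p q = line_int P Q z q - line_int P Q z p).
  { intros [p1 p2] [q1 q2] [Hp1 Hp2] [Hq1 Hq2]. unfold line_int at 1; simpl in *.
    assert (E1 : is_RInt (fun s => P s p2) p1 q1
      (minus (line_int P Q z (q1, p2)) (line_int P Q z (p1, p2)))).
    { apply (is_RInt_derive (fun t => line_int P Q z (t, p2)) (fun s => P s p2)); intros t Ht;
        assert (Ht' : Rabs (t - fst z) < r) by (eapply between_Rabs; [| |apply Ht]; auto).
      - apply (line_int_derive M P Q z r t p2 HC HM). split; assumption.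
      - apply continuous_slice_x, HC, HM. split; auto. }
    assert (E2 : is_RInt (fun t => Q q1 t) p2 q2
      (minus (line_int P Q z (q1, q2)) (line_int P Q z (q1, p2)))).
    { apply (is_RInt_derive (fun t => line_int P Q z (q1, t)) (fun t => Q q1 t)); intros t Ht;
        assert (Ht' : Rabs (t - snd z) < r) by (eapply between_Rabs; [| |apply Ht]; auto).
      - apply (line_int_derive M P Q z r q1 t HC HM). split; assumption.
      - apply continuous_slice_y, HC, HM. split; auto. }
    rewrite (is_RInt_unique _ _ _ _ E1), (is_RInt_unique _ _ _ _ E2).
    unfold minus, plus, opp; simpl; ring. }
  intros p q s Hp Hq Hs. rewrite (H p q), (H q s), (H p s) by assumption. ring.
Qed.

(** * Sums along null-homotopic loops *)

(** The homotopy and path arguments use nothing else about the form. In particular [w p p = 0] on M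
    comes from additivity at p, p, p. *)
Definition locally_additive (M : R * R -> Prop) (w : R * R -> R * R -> R) : Prop :=
  forall z, M z -> exists r, 0 < r /\ (forall q, box z r q -> M q) /\ additive_on (box z r) w.

Lemma line_int_locally_additive M P Q : open M -> closed_form M P Q ->
  locally_additive M (line_int P Q).
Proof.
  intros HM HC z Hz. destruct (open_box M z HM Hz) as [r [Hr HB]].
  exists r. eauto using line_int_additive.
Qed.

Fixpoint psum (f : nat -> R) (n : nat) : R :=
  match n with O => 0 | S n' => psum f n' + f n' end.

Lemma psum_ext f g n : (forall j, (j < n)%nat -> f j = g j) -> psum f n = psum g n.
Proof. induction n; intros H; simpl; [|rewrite H, IHn]; auto. Qed.

Lemma psum_add f n m : psum f (n + m) = psum f n + psum (fun j => f (n + j)%nat) m.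
Proof.
  induction m; simpl; [rewrite Nat.add_0_r; ring|].
  rewrite Nat.add_succ_r; simpl. rewrite IHm; ring.
Qed.

Definition chain_sum (w : R * R -> R * R -> R) (g : R -> R * R) (n : nat) : R :=
  psum (fun j => w (g (INR j / INR n)) (g (INR (S j) / INR n))) n.

(** The cell identities are added along a strip between two rows; each interior rung occurs in two
    neighbouring cells and cancels, leaving the two end rungs. *)
Lemma grid_sum (w : R * R -> R * R -> R) (h : nat -> nat -> R * R) i n :
  (forall j, (j < n)%nat ->
    w (h i j) (h i (S j)) + w (h i (S j)) (h (S i) (S j)) =
    w (h i j) (h (S i) j) + w (h (S i) j) (h (S i) (S j))) ->
  psum (fun j => w (h i j) (h i (S j))) n + w (h i n) (h (S i) n) =
  w (h i 0%nat) (h (S i) 0%nat) + psum (fun j => w (h (S i) j) (h (S i) (S j))) n.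
Proof.
  induction n; intros H; simpl; [ring|].
  specialize (IHn (fun j Hj => H j (Nat.lt_lt_succ_r _ _ Hj))).
  specialize (H n (Nat.lt_succ_diag_r n)). lra.
Qed.

(* Lebesgue number of the cover of the square by preimages of additive boxes. *)
Lemma lebesgue_number M w H : locally_additive M w -> cont_on_R2 square01 H ->
  (forall p, square01 p -> M (H p)) ->
  exists d, 0 < d /\ forall p, square01 p ->
    additive_on (fun q => exists q', square01 q' /\ box p d q' /\ q = H q') w.
Proof.
  intros HL HC HM.
  (* Additivity is secured at radius twice [d], so that a box of radius at most [d] around any point
     [d]-close to (u,v) still fits. Outside the square the radius 1 is a dummy value. *)
  assert (Hloc : forall u v, exists d : posreal, square01 (u, v) ->
    additive_on (fun q => exists q', square01 q' /\ box (u, v) (2 * d) q' /\ q = H q') w).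
  { intros u v. destruct (classic (square01 (u, v))) as [Hs|Hs];
      [|exists (mkposreal 1 Rlt_0_1); tauto].
    destruct (HL _ (HM _ Hs)) as [r [Hr [_ Hadd]]].
    destruct (HC _ Hs (box (H (u, v)) r)) as [eps He].
    { exists (mkposreal r Hr). intros q [H1 H2]; split; assumption. }
    assert (Hd : 0 < eps / 2) by (pose proof (cond_pos eps); lra).
    exists (mkposreal _ Hd). intros _ p q s Hp Hq Hz; simpl in *.
    assert (Hin : forall p, (exists q', square01 q' /\ box (u, v) (2 * (eps / 2)) q' /\ p = H q') ->
      box (H (u, v)) r p).
    { intros p' [q' [Hq' [[H1 H2] ->]]].
      apply He; [|assumption]. replace (2 * (eps / 2)) with (pos eps) in * by field.
      split; assumption. }
    apply Hadd; apply Hin; assumption. }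
  pose (delta u v := proj1_sig (constructive_indefinite_description _ (Hloc u v))).
  destruct (compactness_value_2d 0 1 0 1 delta) as [d Hd].
  exists d; split; [apply cond_pos|]. intros [x y] [Hx Hy]; simpl in *.
  (* Compactness provides the nearby centre (u,v) only under a double negation, hence the argument
     by contradiction. *)
  apply NNPP; intros Hn. apply (Hd x y Hx Hy). intros [u [v [Hu [Hv [Hxu [Hyv Hle]]]]]].
  apply Hn. unfold delta in *.
  destruct (constructive_indefinite_description _ (Hloc u v)) as [e He]; simpl in *.
  assert (Hin : forall p, (exists q', square01 q' /\ box (x, y) d q' /\ p = H q') ->
    (exists q', square01 q' /\ box (u, v) (2 * e) q' /\ p = H q')).
  { intros p [q' [Hq' [[H1 H2] ->]]]. exists q'; split; [|split]; auto. simpl in *.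
    split; simpl; [replace (fst q' - u) with ((fst q' - x) + (x - u)) by ring|
      replace (snd q' - v) with ((snd q' - y) + (y - v)) by ring];
      (eapply Rle_lt_trans; [apply Rabs_triang|lra]). }
  intros p q s Hp Hq Hz. apply He; [split; auto|apply Hin..]; auto.
Qed.

Lemma node_in_I01 i n : (0 < n)%nat -> (i <= n)%nat -> I01 (INR i / INR n).
Proof.
  intros Hn Hi. apply lt_0_INR in Hn. apply le_INR in Hi. pose proof (pos_INR i).
  split; [apply Rdiv_le_0_compat; auto|apply Rle_div_l; lra].
Qed.

Lemma node_step i n d : (0 < n)%nat -> / INR n < d -> Rabs (INR (S i) / INR n - INR i / INR n) < d.
Proof.
  intros Hn Hd. apply lt_0_INR in Hn. rewrite S_INR.
  replace ((INR i + 1) / INR n - INR i / INR n) with (/ INR n) by (field; lra).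
  rewrite Rabs_right; auto. apply Rle_ge, Rlt_le, Rinv_0_lt_compat, Hn.
Qed.

(** A fine grid on the square is mapped by the null-homotopy. Consecutive rows have equal sums, the
    first row is the loop, and the last is a constant with sum 0. *)
Lemma loop_sum_0 M w g : simply_connected M -> locally_additive M w ->
  cont_on_R I01 g -> (forall t, I01 t -> M (g t)) -> g 0 = g 1 ->
  exists N, forall n, (N <= n)%nat -> chain_sum w g n = 0.
Proof.
  intros HS HL Hg HM Hloop.
  destruct (HS g Hg HM Hloop) as [H [HC [HHM [H0 [[c H1] Hside]]]]].
  destruct (lebesgue_number M w H HL HC HHM) as [d [Hd Hadd]].
  destruct (INR_unbounded (/ d)) as [N HN].
  (* The successor makes [n] positive, so that the mesh [/ INR n] is meaningful and below [d]. *)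
  exists (S N); intros n Hn.
  assert (Hn0 : (0 < n)%nat) by lia.
  assert (Hn1 : / INR n < d).
  { rewrite <- (Rinv_inv d). apply Rinv_lt_contravar.
    - apply Rmult_lt_0_compat; [apply Rinv_0_lt_compat|apply lt_0_INR]; auto.
    - apply Rlt_le_trans with (1 := HN), le_INR. lia. }
  pose (h i j := H (INR i / INR n, INR j / INR n)).
  assert (Hnn : INR n / INR n = 1) by (apply Rdiv_diag; apply not_0_INR; lia).
  assert (H00 : INR 0 / INR n = 0) by (simpl; unfold Rdiv; ring).
  assert (Hstep : forall i, (i < n)%nat ->
    psum (fun j => w (h i j) (h i (S j))) n = psum (fun j => w (h (S i) j) (h (S i) (S j))) n).
  { intros i Hi.
    assert (Hsq : psum (fun j => w (h i j) (h i (S j))) n + w (h i n) (h (S i) n) =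
      w (h i 0%nat) (h (S i) 0%nat) + psum (fun j => w (h (S i) j) (h (S i) (S j))) n).
    { apply grid_sum. intros j Hj.
      (* All four corners of a cell lie within [d] of its lower corner, so both ways around the cell
         equal [w] along the diagonal. *)
      assert (Hin : forall i' j', i' = i \/ i' = S i -> j' = j \/ j' = S j ->
        exists q', square01 q' /\ box (INR i / INR n, INR j / INR n) d q' /\ h i' j' = H q').
      { intros i' j' Hi' Hj'. exists (INR i' / INR n, INR j' / INR n). split; [|split]; auto.
        - split; apply node_in_I01; lia.
        - split; simpl fst; simpl snd; [destruct Hi' as [->| ->]|destruct Hj' as [->| ->]];
            try (apply node_step; assumption); rewrite Rminus_diag, Rabs_R0; assumption. }
      assert (Hs : square01 (INR i / INR n, INR j / INR n)) by (split; apply node_in_I01; lia).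
      rewrite !(Hadd _ Hs); auto. }
    (* The end rungs coincide because every intermediate curve of the homotopy is a loop. *)
    enough (w (h i n) (h (S i) n) = w (h i 0%nat) (h (S i) 0%nat)) by lra.
    unfold h. rewrite Hnn, H00, <- !Hside; auto; apply node_in_I01; lia. }
  assert (Hall : forall i, (i <= n)%nat ->
    psum (fun j => w (h 0%nat j) (h 0%nat (S j))) n = psum (fun j => w (h i j) (h i (S j))) n).
  { induction i; intros Hi; auto. rewrite <- Hstep by lia. apply IHi; lia. }
  transitivity (psum (fun j => w (h 0%nat j) (h 0%nat (S j))) n).
  { apply psum_ext; intros j Hj. unfold h. rewrite H00, !H0; auto; apply node_in_I01; lia. }
  rewrite (Hall n), (psum_ext _ (fun _ => w c c)) by
    (auto; intros j Hj; unfold h; rewrite Hnn, !H1; auto; apply node_in_I01; lia).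
  assert (Hcc : w c c = 0).
  { assert (Hc : M c). { rewrite <- (H1 0) by (split; lra). apply HHM. split; split; simpl; lra. }
    destruct (HL c Hc) as [r [Hr [_ Ha]]].
    specialize (Ha c c c (box_center c r Hr) (box_center c r Hr) (box_center c r Hr)). lra. }
  rewrite Hcc. clear. induction n; simpl; lra.
Qed.

(** * Paths and the global potential *)

Definition concat (g1 g2 : R -> R * R) (t : R) : R * R :=
  if Rle_dec t (1 / 2) then g1 (2 * t) else g2 (2 * t - 1).

(** The guard [D (phi s)] stays in the conclusion because [g] is controlled only relative to [D],
    while [phi] may leave [D] near [t]. *)
Lemma cont_on_pullback (D : R -> Prop) (g : R -> R * R) (phi : R -> R) t (P : R * R -> Prop) :
  cont_on_R D g -> continuous phi t -> D (phi t) -> locally (g (phi t)) P ->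
  locally t (fun s => D (phi s) -> P (g (phi s))).
Proof. intros Hg Hphi Ht HP. exact (Hphi _ (Hg _ Ht P HP)). Qed.

Lemma cont_on_reverse g : cont_on_R I01 g -> cont_on_R I01 (fun t => g (1 - t)).
Proof.
  intros Hg t Ht P HP. unfold filtermap, within.
  refine (filter_imp _ _ _ (cont_on_pullback I01 g (fun s => 1 - s) t P Hg _ _ HP)).
  - intros s Hs Hs'. apply Hs. unfold I01 in *; lra.
  - apply (continuous_minus (K := R_AbsRing) (V := R_NormedModule));
      [apply continuous_const|apply continuous_id].
  - unfold I01 in *; lra.
Qed.

Lemma continuous_affine a b t : continuous (fun s : R => a + s * b) t.
Proof.
  apply (ex_derive_continuous (K := R_AbsRing) (V := R_NormedModule)).
  auto_derive; auto.
Qed.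

Lemma cont_on_concat g1 g2 : cont_on_R I01 g1 -> cont_on_R I01 g2 -> g1 1 = g2 0 ->
  cont_on_R I01 (concat g1 g2).
Proof.
  intros H1 H2 Hj t Ht P HP. unfold filtermap, within.
  assert (L1 : t <= 1 / 2 -> locally t (fun s => I01 (2 * s) -> P (g1 (2 * s)))).
  { intros Hle. apply (cont_on_pullback I01 g1 (fun s => 2 * s)); auto.
    - apply (ex_derive_continuous (K := R_AbsRing) (V := R_NormedModule)). auto_derive; auto.
    - unfold I01 in *; lra.
    - unfold concat in HP. destruct (Rle_dec t (1 / 2)); [assumption|lra]. }
  assert (L2 : 1 / 2 <= t -> locally t (fun s => I01 (2 * s - 1) -> P (g2 (2 * s - 1)))).
  { intros Hle. apply (cont_on_pullback I01 g2 (fun s => 2 * s - 1)); auto.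
    - apply (ex_derive_continuous (K := R_AbsRing) (V := R_NormedModule)). auto_derive; auto.
    - unfold I01 in *; lra.
    (* At 1/2 the first branch of [concat] applies, so the neighbourhood is one of [g1 1]; the
       junction condition turns it into one of [g2 0]. *)
    - unfold concat in HP. destruct (Rle_dec t (1 / 2)) as [Hle'|]; [|assumption].
      replace t with (1 / 2) in * by lra.
      replace (2 * (1 / 2) - 1) with 0 by lra. replace (2 * (1 / 2)) with 1 in HP by lra.
      rewrite <- Hj. assumption. }
  unfold I01, concat in *.
  destruct (Rtotal_order t (1 / 2)) as [Hlt|[Heq|Hgt]].
  - generalize (filter_and _ _ (L1 (Rlt_le _ _ Hlt)) (open_lt (1 / 2) t Hlt)).
    apply filter_imp. intros s [Hs Hs'] HI. destruct (Rle_dec s (1 / 2)); [apply Hs|]; lra.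
  - generalize (filter_and _ _ (L1 (Req_le _ _ Heq)) (L2 (Req_le _ _ (eq_sym Heq)))).
    apply filter_imp. intros s [Hs Hs'] HI.
    destruct (Rle_dec s (1 / 2)); [apply Hs|apply Hs']; lra.
  - generalize (filter_and _ _ (L2 (Rlt_le _ _ Hgt)) (open_gt (1 / 2) t Hgt)).
    apply filter_imp. intros s [Hs Hs'] HI. destruct (Rle_dec s (1 / 2)); [|apply Hs]; lra.
Qed.

Lemma concat_in (M : R * R -> Prop) g1 g2 : (forall t, I01 t -> M (g1 t)) ->
  (forall t, I01 t -> M (g2 t)) -> forall t, I01 t -> M (concat g1 g2 t).
Proof.
  intros H1 H2 t Ht. unfold concat, I01 in *.
  destruct (Rle_dec t (1 / 2)); [apply H1|apply H2]; lra.
Qed.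

Lemma concat_0 g1 g2 : concat g1 g2 0 = g1 0.
Proof. unfold concat. destruct (Rle_dec 0 (1 / 2)); [f_equal|]; lra. Qed.

Lemma concat_1 g1 g2 : concat g1 g2 1 = g2 1.
Proof. unfold concat. destruct (Rle_dec 1 (1 / 2)); [|f_equal]; lra. Qed.

(** With 2n pieces the junction is itself a node, so the nodes split exactly into those of the two
    paths. *)
Lemma chain_sum_concat w g1 g2 n : (0 < n)%nat -> g1 1 = g2 0 ->
  chain_sum w (concat g1 g2) (n + n) = chain_sum w g1 n + chain_sum w g2 n.
Proof.
  intros Hn Hj. unfold chain_sum. rewrite psum_add.
  assert (Hn' : 0 < INR n) by (apply lt_0_INR; assumption).
  assert (E1 : forall j, (j <= n)%nat -> concat g1 g2 (INR j / INR (n + n)) = g1 (INR j / INR n)).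
  { intros j Hle. apply le_INR in Hle. rewrite plus_INR. unfold concat.
    destruct (Rle_dec _ _) as [_|Hc]; [f_equal; field; lra|].
    exfalso; apply Hc, Rle_div_l; lra. }
  assert (E2 : forall j, concat g1 g2 (INR (n + j) / INR (n + n)) = g2 (INR j / INR n)).
  { intros [|j].
    - rewrite Nat.add_0_r, E1, Rdiv_diag, Hj by (auto; lra). f_equal. simpl. field; lra.
    - rewrite !plus_INR. unfold concat.
      destruct (Rle_dec _ _) as [Hc|_]; [|f_equal; field; lra].
      apply (Rle_div_l _ _ (INR n + INR n)) in Hc; [|lra]. rewrite S_INR in Hc. pose proof (pos_INR j). lra. }
  f_equal; apply psum_ext; intros j Hlt.
  - rewrite !E1 by lia. reflexivity.
  - rewrite <- Nat.add_succ_r, !E2. reflexivity.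
Qed.

Definition is_path (M : R * R -> Prop) (p q : R * R) (g : R -> R * R) : Prop :=
  cont_on_R I01 g /\ (forall t, I01 t -> M (g t)) /\ g 0 = p /\ g 1 = q.

(* Dyadic subdivisions suffice and are compatible with [concat]. *)
Definition path_value (M : R * R -> Prop) w (p q : R * R) (c : R) : Prop :=
  exists g, is_path M p q g /\ exists k0, forall k, (k0 <= k)%nat -> chain_sum w g (2 ^ k) = c.

Lemma is_path_concat M p q s g1 g2 : is_path M p q g1 -> is_path M q s g2 ->
  is_path M p s (concat g1 g2).
Proof.
  intros [C1 [M1 [S1 T1]]] [C2 [M2 [S2 T2]]]. repeat split.
  - apply cont_on_concat; [assumption..|congruence].
  - apply concat_in; assumption.
  - rewrite concat_0; assumption.
  - rewrite concat_1; assumption.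
Qed.

Lemma chain_sum_concat_dyadic M w p q s g1 g2 k : is_path M p q g1 -> is_path M q s g2 ->
  chain_sum w (concat g1 g2) (2 ^ S k) = chain_sum w g1 (2 ^ k) + chain_sum w g2 (2 ^ k).
Proof.
  intros [_ [_ [_ T1]]] [_ [_ [S2 _]]].
  replace (2 ^ S k)%nat with (2 ^ k + 2 ^ k)%nat by (simpl; lia).
  apply chain_sum_concat; [|congruence]. pose proof (Nat.pow_nonzero 2 k); lia.
Qed.

Lemma is_path_reverse M p q g : is_path M p q g -> is_path M q p (fun t => g (1 - t)).
Proof.
  intros [C [HM [S T]]]. repeat split.
  - apply cont_on_reverse, C.
  - intros t Ht. apply HM. unfold I01 in *; lra.
  - rewrite Rminus_0_r; assumption.
  - rewrite Rminus_diag; assumption.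
Qed.

Lemma pow2_ge_id k : (k <= 2 ^ k)%nat.
Proof. apply Nat.lt_le_incl, Nat.pow_gt_lin_r; lia. Qed.

(* Closing either path by one and the same return path gives a loop of sum 0. *)
Lemma path_value_unique M w p q c1 c2 : simply_connected M -> locally_additive M w ->
  path_value M w p q c1 -> path_value M w p q c2 -> c1 = c2.
Proof.
  intros HS HL [g1 [P1 [k1 H1]]] [g2 [P2 [k2 H2]]].
  pose proof (is_path_reverse _ _ _ _ P1) as PR.
  (* Any path from p to q followed by the reverse of [g1] is a loop, so the reverse has sums
     eventually [- c]. Using this for both paths at one common level compares [c1] and [c2]. *)
  assert (HA : forall g c k0, is_path M p q g ->
    (forall k, (k0 <= k)%nat -> chain_sum w g (2 ^ k) = c) ->
    exists k0', forall k, (k0' <= k)%nat -> chain_sum w (fun t => g1 (1 - t)) (2 ^ k) = - c).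
  { intros g c k0 HP Hc. pose proof (is_path_concat _ _ _ _ _ _ HP PR) as [C [HM [S T]]].
    destruct (loop_sum_0 M w _ HS HL C HM) as [N HN]; [congruence|].
    exists (max k0 N). intros k Hk.
    assert (HN' : (N <= 2 ^ Datatypes.S k)%nat)
      by (apply Nat.le_trans with (2 := pow2_ge_id _); lia).
    specialize (HN _ HN'). rewrite (chain_sum_concat_dyadic M w _ _ _ _ _ _ HP PR) in HN.
    rewrite Hc in HN by lia. lra. }
  destruct (HA _ _ _ P1 H1) as [k1' E1], (HA _ _ _ P2 H2) as [k2' E2].
  specialize (E1 (max k1' k2') (Nat.le_max_l _ _)).
  specialize (E2 (max k1' k2') (Nat.le_max_r _ _)). lra.
Qed.

(** * Segments in boxes and continuation of path values *)

Definition segment (p q : R * R) (t : R) : R * R :=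
  (fst p + t * (fst q - fst p), snd p + t * (snd q - snd p)).

Lemma segment_in_box z r p q t : box z r p -> box z r q -> I01 t -> box z r (segment p q t).
Proof.
  assert (H : forall a b c, Rabs (b - a) < r -> Rabs (c - a) < r -> I01 t ->
    Rabs (b + t * (c - b) - a) < r).
  { intros a b c Hb Hc [H0 H1]. apply (between_Rabs a b c r); auto.
    unfold Rmin, Rmax. destruct (Rle_dec b c); split; nra. }
  intros [H1 H2] [H3 H4] Ht. split; apply H; assumption.
Qed.

(** All nodes stay in the convex box, so partial sums telescope exactly for every [n], with no
    passage to a limit. *)
Lemma chain_sum_segment w z r p q n : additive_on (box z r) w -> box z r p -> box z r q ->
  (0 < n)%nat -> chain_sum w (segment p q) n = w p q.
Proof.
  intros Ha Hp Hq Hn.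
  assert (S0 : segment p q 0 = p) by (destruct p; unfold segment; simpl; f_equal; ring).
  assert (S1 : segment p q 1 = q) by (destruct p, q; unfold segment; simpl; f_equal; ring).
  assert (H : forall m, (m <= n)%nat ->
    psum (fun j => w (segment p q (INR j / INR n)) (segment p q (INR (S j) / INR n))) m =
    w p (segment p q (INR m / INR n))).
  { induction m; intros Hm.
    - replace (INR 0 / INR n) with 0 by (simpl; unfold Rdiv; ring). rewrite S0.
      specialize (Ha p p p Hp Hp Hp). simpl. lra.
    - cbn [psum]. rewrite IHm by lia.
      apply Ha; auto; apply segment_in_box; auto; apply node_in_I01; lia. }
  unfold chain_sum. rewrite H, Rdiv_diag, S1; auto. apply not_0_INR; lia.
Qed.

Lemma is_path_segment M z r p q : (forall s, box z r s -> M s) -> box z r p -> box z r q ->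
  is_path M p q (segment p q).
Proof.
  intros HM Hp Hq. repeat split.
  - intros t _. apply (filterlim_filter_le_1 (F := locally t) _ (filter_le_within _)).
    apply (continuous_comp_2 (X := prod_UniformSpace R_UniformSpace R_UniformSpace)
      (fun t => fst p + t * (fst q - fst p)) (fun t => snd p + t * (snd q - snd p))
      (fun a b : R => (a, b))); try apply continuous_affine.
    intros P HP. unfold filtermap. cbn beta in HP. rewrite <- surjective_pairing in HP.
    revert HP. apply filter_imp. intros []; auto.
  - intros t Ht. apply HM, segment_in_box; assumption.
  - destruct p; unfold segment; simpl; f_equal; ring.
  - destruct p, q; unfold segment; simpl; f_equal; ring.
Qed.

Lemma path_value_extend M w z r z0 p q c : (forall s, box z r s -> M s) ->
  additive_on (box z r) w -> box z r p -> box z r q ->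
  path_value M w z0 p c -> path_value M w z0 q (c + w p q).
Proof.
  intros HM Ha Hp Hq [g [Pg [k0 Hk]]].
  pose proof (is_path_segment M z r p q HM Hp Hq) as Ps.
  exists (concat g (segment p q)). split; [apply (is_path_concat _ _ _ _ _ _ Pg Ps)|].
  (* Level k+1 of the concatenation consists of level k of each part, so the threshold rises by
     one. *)
  exists (S k0). intros [|k] Hle; [lia|].
  rewrite (chain_sum_concat_dyadic _ _ _ _ _ _ _ _ Pg Ps), Hk by lia.
  rewrite (chain_sum_segment w z r) by (auto; pose proof (Nat.pow_nonzero 2 k); lia).
  reflexivity.
Qed.

Lemma path_value_base M w z : locally_additive M w -> M z -> path_value M w z z 0.
Proof.
  intros HL Hz. destruct (HL z Hz) as [r [Hr [HM Ha]]].
  pose proof (box_center z r Hr) as Hc.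
  exists (segment z z). split; [eapply is_path_segment; eauto|].
  exists 0%nat. intros k _.
  rewrite (chain_sum_segment w z r) by (auto; pose proof (Nat.pow_nonzero 2 k); lia).
  specialize (Ha z z z Hc Hc Hc). lra.
Qed.

(** The points with a path value and those without one form two disjoint open sets covering M. This
    yields both a path and the stabilization of its sums. *)
Lemma path_value_exists M w z0 z : open M -> connected_set M -> locally_additive M w -> M z0 -> M z ->
  exists c, path_value M w z0 z c.
Proof.
  intros HO HC HL Hz0 Hz. apply NNPP; intros Hn. apply HC.
  assert (Hbox : forall p r, 0 < r -> locally p (box p r)).
  { intros p r Hr. exists (mkposreal r Hr). intros q [H1 H2]; split; assumption. }
  exists (fun p => M p /\ exists c, path_value M w z0 p c).
  exists (fun p => M p /\ ~ exists c, path_value M w z0 p c).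
  refine (conj _ (conj _ (conj _ (conj _ (conj _ _))))).
  - intros p [Hp [c Hv]]. destruct (HL p Hp) as [r [Hr [HM Ha]]].
    apply filter_imp with (2 := Hbox p r Hr). intros q Hq. split; [apply HM, Hq|].
    exists (c + w p q). apply (path_value_extend M w p r); auto using box_center.
  (* If a point [q] of the box had a value, the segment from [q] back to [p] would give one at
     [p]. *)
  - intros p [Hp Hv]. destruct (HL p Hp) as [r [Hr [HM Ha]]].
    apply filter_imp with (2 := Hbox p r Hr). intros q Hq. split; [apply HM, Hq|].
    intros [c Hc]. apply Hv. exists (c + w q p).
    apply (path_value_extend M w p r); auto using box_center.
  - intros p Hp. destruct (classic (exists c, path_value M w z0 p c)); [left|right]; auto.
  - tauto.
  - exists z0. eauto using path_value_base.
  - exists z. auto.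
Qed.

(** Near (x,y) the potential is a constant plus the integral from (x,y), whose partial derivatives
    are already known. *)
Lemma closed_form_exact M P Q x0 y0 : open M -> connected_set M -> simply_connected M ->
  closed_form M P Q -> M (x0, y0) ->
  exists f : R -> R -> R, f x0 y0 = 0 /\
    forall x y, M (x, y) ->
      is_derive (fun t => f t y) x (P x y) /\ is_derive (fun t => f x t) y (Q x y).
Proof.
  intros HO HC HS HF H0.
  pose proof (line_int_locally_additive M P Q HO HF) as HL.
  set (w := line_int P Q) in *.
  (* A choice of the value by description; it is evaluated only on M, where existence and uniqueness
     hold. *)
  pose (val z := iota (T := R_CompleteSpace) (path_value M w (x0, y0) z)).
  assert (Hval : forall z c, M z -> path_value M w (x0, y0) z c -> val z = c).
  { intros z c Hz Hc. apply (iota_unique (V := R_CompleteNormedModule)); [|assumption].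
    intros c' Hc'. eapply path_value_unique; eauto. }
  exists (fun x y => val (x, y)). split.
  { apply Hval; auto. apply path_value_base; auto. }
  intros x y Hxy. destruct (open_box M _ HO Hxy) as [r [Hr HM]].
  pose proof (box_center _ _ Hr : box (x, y) r (x, y)) as Hc.
  destruct (path_value_exists M w (x0, y0) (x, y) HO HC HL H0 Hxy) as [c Hv].
  assert (Hloc : forall q, box (x, y) r q -> c + w (x, y) q = val q).
  { intros q Hq. symmetry. apply Hval; auto.
    apply (path_value_extend M w (x, y) r); auto. apply (line_int_additive M); assumption. }
  destruct (line_int_derive M P Q (x, y) r x y HF HM Hc) as [D1 D2].
  destruct Hc as [Hx Hy]; simpl in Hx, Hy. fold w in D1, D2. split.
  - apply is_derive_ext_loc with (fun t => c + w (x, y) (t, y)).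
    + apply filter_imp with (2 := locally_Rabs _ _ _ Hx). intros t Ht.
      apply Hloc. split; assumption.
    + replace (P x y) with (0 + P x y) by ring.
      apply (is_derive_plus (K := R_AbsRing) (V := R_NormedModule)); auto.
      apply (is_derive_const (K := R_AbsRing) (V := R_NormedModule)).
  - apply is_derive_ext_loc with (fun t => c + w (x, y) (x, t)).
    + apply filter_imp with (2 := locally_Rabs _ _ _ Hy). intros t Ht.
      apply Hloc. split; assumption.
    + replace (Q x y) with (0 + Q x y) by ring.
      apply (is_derive_plus (K := R_AbsRing) (V := R_NormedModule)); auto.
      apply (is_derive_const (K := R_AbsRing) (V := R_NormedModule)).
Qed.

(** * The first fundamental form of a minimal graph *)

Lemma px_const c : px (fun _ _ => c) = fun _ _ => 0.
Proof. do 2 (apply functional_extensionality; intro). unfold px, py; apply Derive_const. Qed.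

Lemma py_const c : py (fun _ _ => c) = fun _ _ => 0.
Proof. do 2 (apply functional_extensionality; intro). unfold px, py; apply Derive_const. Qed.

Lemma px_fst : px (fun x _ => x) = fun _ _ => 1.
Proof. do 2 (apply functional_extensionality; intro). unfold px, py; apply Derive_id. Qed.

Lemma py_fst : py (fun x _ => x) = fun _ _ => 0.
Proof. do 2 (apply functional_extensionality; intro). unfold px, py; apply Derive_const. Qed.

Lemma px_snd : px (fun _ y => y) = fun _ _ => 0.
Proof. do 2 (apply functional_extensionality; intro). unfold px, py; apply Derive_const. Qed.

Lemma py_snd : py (fun _ y => y) = fun _ _ => 1.
Proof. do 2 (apply functional_extensionality; intro). unfold px, py; apply Derive_id. Qed.

Lemma Ck_const k U c : Ck k U (fun _ _ => c).
Proof.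
  revert c; induction k as [|k IH]; intros c.
  - intros p _. apply continuous_const.
  - simpl. rewrite px_const, py_const. auto using ex_derive_const.
Qed.

Lemma Ck_fst k U : Ck k U (fun x _ => x).
Proof.
  induction k as [|k IH].
  - intros p _. apply continuous_fst.
  - simpl. rewrite px_fst, py_fst. auto using ex_derive_const, ex_derive_id, Ck_const.
Qed.

Lemma Ck_snd k U : Ck k U (fun _ y => y).
Proof.
  induction k as [|k IH].
  - intros p _. apply continuous_snd.
  - simpl. rewrite px_snd, py_snd. auto using ex_derive_const, ex_derive_id, Ck_const.
Qed.

(** [Xxy] is the y-derivative of X_x, while differentiating F and G in x produces the x-derivative
    of X_y; Schwarz's theorem identifies them. *)
Lemma mixed_partials M f x y : open M -> Ck 2 M f -> M (x, y) -> px (py f) x y = py (px f) x y.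
Proof.
  intros HO [D0 [_ [[Dx [_ [_ Cxy]]] [Dy [_ [Cyx _]]]]]] Hxy.
  apply (Schwarz f).
  - apply locally_2d_locally, filter_imp with (2 := HO _ Hxy). intros [s t] Hst. 
    exact (conj (proj1 (D0 s t Hst)) (conj (proj2 (D0 s t Hst))
      (conj (proj1 (Dy s t Hst)) (proj2 (Dx s t Hst))))).
  - apply continuity_2d_pt_filterlim, (Cyx (x, y) Hxy).
  - apply continuity_2d_pt_filterlim, (Cxy (x, y) Hxy).
Qed.

(** * Derivative and continuity rules for the expressions in E, F, G, W *)

Lemma is_derive_Rmult (f g : R -> R) (s f' g' : R) : is_derive f s f' -> is_derive g s g' ->
  is_derive (fun t => f t * g t) s (f' * g s + f s * g').
Proof. intros Hf Hg. apply (is_derive_mult (K := R_AbsRing)); auto. intros; apply Rmult_comm. Qed.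

Lemma is_derive_Rplus (f g : R -> R) (s f' g' : R) : is_derive f s f' -> is_derive g s g' ->
  is_derive (fun t => f t + g t) s (f' + g').
Proof. apply (is_derive_plus (K := R_AbsRing) (V := R_NormedModule)). Qed.

Lemma is_derive_lor (V W : R -> nat -> R) (dV dW : nat -> R) s :
  (forall i, is_derive (fun t => V t i) s (dV i)) ->
  (forall i, is_derive (fun t => W t i) s (dW i)) ->
  is_derive (fun t => lor (V t) (W t)) s (lor dV (W s) + lor (V s) dW).
Proof.
  intros HV HW. unfold lor.
  evar_last.
  - do 3 (try (apply is_derive_Rplus; [|apply is_derive_Rmult; [apply HV|apply HW]])).
    apply is_derive_Rmult; [|apply HW].
    apply (is_derive_opp (K := R_AbsRing) (V := R_NormedModule)), HV.
  - unfold opp; simpl; ring.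
Qed.

(** Written over the cube of the root, so that equality of two such derivatives reduces to a
    polynomial identity between numerators. *)
Lemma is_derive_div_sqrt (n D : R -> R) (s n' D' : R) : is_derive n s n' -> is_derive D s D' -> 0 < D s ->
  is_derive (fun t => n t / sqrt (D t)) s ((n' * D s - n s * (D' / 2)) / sqrt (D s) ^ 3).
Proof.
  intros Hn HD Hpos. assert (Hs : 0 < sqrt (D s)) by (apply sqrt_lt_R0; assumption).
  replace ((n' * D s - n s * (D' / 2)) / sqrt (D s) ^ 3)
    with ((n' * sqrt (D s) - n s * (D' / (2 * sqrt (D s)))) / sqrt (D s) ^ 2).
  - apply (is_derive_div n (fun t => sqrt (D t))); [assumption|apply is_derive_sqrt; assumption|lra].
  - assert (Hq : D s = sqrt (D s) * sqrt (D s)) by (symmetry; apply sqrt_sqrt; lra).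
    set (q := sqrt (D s)) in *. clearbody q. rewrite Hq. field; lra.
Qed.

Lemma is_derive_disc (e g f : R -> R) (s e' g' f' : R) : is_derive e s e' -> is_derive g s g' ->
  is_derive f s f' ->
  is_derive (fun t => e t * g t - f t ^ 2) s (e' * g s + e s * g' - 2 * f s * f').
Proof.
  intros He Hg Hf. evar_last.
  - apply (is_derive_minus (K := R_AbsRing) (V := R_NormedModule)).
    + apply is_derive_Rmult; eassumption.
    + apply is_derive_pow; eassumption.
  - unfold minus, plus, opp; simpl; ring.
Qed.

Lemma continuous_Rplus {U : UniformSpace} (f g : U -> R) p :
  continuous f p -> continuous g p -> continuous (fun q => f q + g q) p.
Proof. apply (continuous_plus (K := R_AbsRing) (V := R_NormedModule)). Qed.

Lemma continuous_Rminus {U : UniformSpace} (f g : U -> R) p :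
  continuous f p -> continuous g p -> continuous (fun q => f q - g q) p.
Proof. apply (continuous_minus (K := R_AbsRing) (V := R_NormedModule)). Qed.

Lemma continuous_Rmult {U : UniformSpace} (f g : U -> R) p :
  continuous f p -> continuous g p -> continuous (fun q => f q * g q) p.
Proof. apply (continuous_mult (K := R_AbsRing)). Qed.

Lemma continuous_Rdiv {U : UniformSpace} (f g : U -> R) p :
  continuous f p -> continuous g p -> g p <> 0 -> continuous (fun q => f q / g q) p.
Proof.
  intros Hf Hg H0. apply continuous_Rmult; [assumption|].
  apply (continuous_comp g Rinv); [assumption|apply continuous_Rinv, H0].
Qed.

Lemma continuous_Rpow {U : UniformSpace} (f : U -> R) n p :
  continuous f p -> continuous (fun q => f q ^ n) p.
Proof.
  intros Hf. induction n; simpl; [apply continuous_const|apply continuous_Rmult; assumption].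
Qed.

Lemma continuous_lor {U : UniformSpace} (V W : U -> nat -> R) p :
  (forall i, continuous (fun q => V q i) p) -> (forall i, continuous (fun q => W q i) p) ->
  continuous (fun q => lor (V q) (W q)) p.
Proof.
  intros HV HW. unfold lor.
  repeat apply continuous_Rplus; apply continuous_Rmult; auto.
  apply (continuous_opp (K := R_AbsRing) (V := R_NormedModule)), HV.
Qed.

(** * Derivatives of E, F, G and the tangential part of N *)

Lemma fff_derive M X x y : open M -> (forall i, Ck 2 M (X i)) -> M (x, y) ->
  let xx := Xxx X x y in let xy := Xxy X x y in let yy := Xyy X x y in
  (is_derive (fun t => EE X t y) x (2 * lor xx (Xx X x y)) /\
   is_derive (fun t => EE X x t) y (2 * lor xy (Xx X x y))) /\
  (is_derive (fun t => FF X t y) x (lor xx (Xy X x y) + lor xy (Xx X x y)) /\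
   is_derive (fun t => FF X x t) y (lor xy (Xy X x y) + lor yy (Xx X x y))) /\
  (is_derive (fun t => GG X t y) x (2 * lor xy (Xy X x y)) /\
   is_derive (fun t => GG X x t) y (2 * lor yy (Xy X x y))).
Proof.
  intros HO HX Hxy xx xy yy.
  assert (Sym : forall V W, lor V W = lor W V) by (intros; unfold lor; ring).
  assert (D : forall i,
    (is_derive (fun t => Xx X t y i) x (xx i) /\ is_derive (fun t => Xx X x t i) y (xy i)) /\
    (is_derive (fun t => Xy X t y i) x (xy i) /\ is_derive (fun t => Xy X x t i) y (yy i))).
  { intros i. pose proof (HX i) as [_ [_ [[Dx _] [Dy _]]]].
    destruct (Dx x y Hxy), (Dy x y Hxy). refine (conj (conj _ _) (conj _ _)); try (apply Derive_correct; assumption).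
    unfold xy, Xxy. rewrite <- (mixed_partials M) by auto. apply Derive_correct; assumption. }
  assert (Dxx := fun i => proj1 (proj1 (D i))). assert (Dxy := fun i => proj2 (proj1 (D i))).
  assert (Dyx := fun i => proj1 (proj2 (D i))). assert (Dyy := fun i => proj2 (proj2 (D i))).
  assert (Conv : forall (h : R -> R) (s a b : R), is_derive h s a -> a = b -> is_derive h s b)
    by (intros; subst; assumption).
  refine (conj (conj _ _) (conj (conj _ _) (conj _ _))); eapply Conv.
  - apply (is_derive_lor (fun t => Xx X t y) (fun t => Xx X t y)); eassumption.
  - rewrite (Sym (Xx X x y)). ring.
  - apply (is_derive_lor (fun t => Xx X x t) (fun t => Xx X x t)); eassumption.
  - rewrite (Sym (Xx X x y)). ring.
  - apply (is_derive_lor (fun t => Xx X t y) (fun t => Xy X t y)); eassumption.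
  - rewrite (Sym (Xx X x y)). ring.
  - apply (is_derive_lor (fun t => Xx X x t) (fun t => Xy X x t)); eassumption.
  - rewrite (Sym (Xx X x y)). ring.
  - apply (is_derive_lor (fun t => Xy X t y) (fun t => Xy X t y)); eassumption.
  - rewrite (Sym (Xy X x y)). ring.
  - apply (is_derive_lor (fun t => Xy X x t) (fun t => Xy X x t)); eassumption.
  - rewrite (Sym (Xy X x y)). ring.
Qed.

(* The vector N in the definition of HH_unnorm. *)
Definition curv_trace X x y : nat -> R :=
  fun i => GG X x y * Xxx X x y i - 2 * FF X x y * Xxy X x y i + EE X x y * Xyy X x y i.

(** In components [ix] and [iy] the vector N vanishes, while X_x and X_y have entries (1,0) and
    (0,1). Minimality there kills both coefficients of the tangential projection, and the Gram
    matrix, of determinant D > 0, then forces a = b = 0. *)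
Lemma minimal_graph_tangential M X ix iy x y : spacelike_on M X -> minimal_on M X ->
  (ix < 4)%nat -> (iy < 4)%nat -> X ix = (fun x _ => x) -> X iy = (fun _ y => y) -> M (x, y) ->
  lor (curv_trace X x y) (Xx X x y) = 0 /\ lor (curv_trace X x y) (Xy X x y) = 0.
Proof.
  intros HS HMin Hix Hiy Ex Ey Hxy. destruct (HS x y Hxy) as [HE HD].
  set (E := EE X x y) in *. set (F := FF X x y) in *. set (G := GG X x y) in *.
  set (a := lor (curv_trace X x y) (Xx X x y)) in *. set (b := lor (curv_trace X x y) (Xy X x y)) in *.
  set (D := E * G - F ^ 2) in *.
  assert (Key : forall i, (i < 4)%nat ->
    Xxx X x y i = 0 -> Xxy X x y i = 0 -> Xyy X x y i = 0 ->
    (G * a - F * b) / D * Xx X x y i + (- F * a + E * b) / D * Xy X x y i = 0).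
  { intros i Hi Z1 Z2 Z3. pose proof (HMin x y Hxy i Hi) as H.
    change (G * Xxx X x y i - 2 * F * Xxy X x y i + E * Xyy X x y i -
      ((G * a - F * b) / D * Xx X x y i + (- F * a + E * b) / D * Xy X x y i) = 0) in H.
    rewrite Z1, Z2, Z3 in H. lra. }
  assert (C1 : (G * a - F * b) / D = 0).
  { assert (H := Key ix Hix). unfold Xxx, Xxy, Xyy, Xx, Xy in H.
    rewrite Ex, px_fst, py_fst, px_const, !py_const in H. lra. }
  assert (C2 : (- F * a + E * b) / D = 0).
  { assert (H := Key iy Hiy). unfold Xxx, Xxy, Xyy, Xx, Xy in H.
    rewrite Ey, px_snd, py_snd, px_const, !py_const in H. lra. }
  assert (D1 : G * a - F * b = 0) by (apply (Rmult_eq_reg_r (/ D)); [lra|apply Rinv_neq_0_compat; lra]).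
  assert (D2 : - F * a + E * b = 0) by (apply (Rmult_eq_reg_r (/ D)); [lra|apply Rinv_neq_0_compat; lra]).
  split; apply (Rmult_eq_reg_l D); try lra.
  (* Multiplying the adjugate system by the Gram matrix itself recovers D a and D b. *)
  - replace (D * a) with (E * (G * a - F * b) + F * (- F * a + E * b)) by (unfold D; ring).
    rewrite D1, D2; ring.
  - replace (D * b) with (F * (G * a - F * b) + G * (- F * a + E * b)) by (unfold D; ring).
    rewrite D1, D2; ring.
Qed.

Definition disc X x y : R := EE X x y * GG X x y - FF X x y ^ 2.
(* The partial derivatives of disc, written with the second derivatives of X. *)
Definition disc_y X x y : R :=
  2 * lor (Xxy X x y) (Xx X x y) * GG X x y + EE X x y * (2 * lor (Xyy X x y) (Xy X x y)) -
  2 * FF X x y * (lor (Xxy X x y) (Xy X x y) + lor (Xyy X x y) (Xx X x y)).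
Definition disc_x X x y : R :=
  2 * lor (Xxx X x y) (Xx X x y) * GG X x y + EE X x y * (2 * lor (Xxy X x y) (Xy X x y)) -
  2 * FF X x y * (lor (Xxx X x y) (Xy X x y) + lor (Xxy X x y) (Xx X x y)).

(** The products listed are those in E_y and F_y, since the continuous function required by
    [closed_form] will be the y-derivative of the first coefficient. *)
Lemma continuous_fff M X p : (forall i, Ck 2 M (X i)) -> M p ->
  let at_p (f : (nat -> R -> R -> R) -> R -> R -> R) := continuous (fun q => f X (fst q) (snd q)) p in
  at_p EE /\ at_p FF /\ at_p GG /\ at_p disc_y /\
  at_p (fun X x y => lor (Xxy X x y) (Xx X x y)) /\
  at_p (fun X x y => lor (Xxy X x y) (Xy X x y)) /\
  at_p (fun X x y => lor (Xyy X x y) (Xx X x y)).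
Proof.
  intros HX Hp at_p.
  assert (C1 : forall i, continuous (fun q => Xx X (fst q) (snd q) i) p)
    by (intros i; destruct (HX i) as [_ [_ [[_ [C [_ _]]] _]]]; exact (C p Hp)).
  assert (C2 : forall i, continuous (fun q => Xy X (fst q) (snd q) i) p)
    by (intros i; destruct (HX i) as [_ [_ [_ [_ [C [_ _]]]]]]; exact (C p Hp)).
  assert (C3 : forall i, continuous (fun q => Xxy X (fst q) (snd q) i) p)
    by (intros i; destruct (HX i) as [_ [_ [[_ [_ [_ C]]] _]]]; exact (C p Hp)).
  assert (C4 : forall i, continuous (fun q => Xyy X (fst q) (snd q) i) p)
    by (intros i; destruct (HX i) as [_ [_ [_ [_ [_ [_ C]]]]]]; exact (C p Hp)).
  assert (CE : at_p EE) by (apply continuous_lor; assumption).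
  assert (CF : at_p FF) by (apply continuous_lor; assumption).
  assert (CG : at_p GG) by (apply continuous_lor; assumption).
  assert (L1 : at_p (fun X x y => lor (Xxy X x y) (Xx X x y))) by (apply continuous_lor; assumption).
  assert (L2 : at_p (fun X x y => lor (Xxy X x y) (Xy X x y))) by (apply continuous_lor; assumption).
  assert (L3 : at_p (fun X x y => lor (Xyy X x y) (Xx X x y))) by (apply continuous_lor; assumption).
  assert (L4 : at_p (fun X x y => lor (Xyy X x y) (Xy X x y))) by (apply continuous_lor; assumption).
  refine (conj CE (conj CF (conj CG (conj _ (conj L1 (conj L2 L3)))))).
  apply continuous_Rminus; [apply continuous_Rplus|]; repeat apply continuous_Rmult;
    try apply continuous_const; try assumption.
  apply continuous_Rplus; assumption.
Qed.

Lemma continuous_WW M X p : (forall i, Ck 2 M (X i)) -> M p ->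
  continuous (fun q => WW X (fst q) (snd q)) p.
Proof.
  intros HX Hp. destruct (continuous_fff M X p HX Hp) as [CE [CF [CG _]]].
  apply (continuous_comp (fun q => EE X (fst q) (snd q) * GG X (fst q) (snd q) - FF X (fst q) (snd q) ^ 2)
    sqrt); [|apply continuous_sqrt].
  apply continuous_Rminus; [apply continuous_Rmult|apply continuous_Rpow]; assumption.
Qed.

Lemma WW_pos M X x y : spacelike_on M X -> M (x, y) -> 0 < WW X x y.
Proof. intros HS Hxy. apply sqrt_lt_R0, HS, Hxy. Qed.

Lemma WW_sqr M X x y : spacelike_on M X -> M (x, y) -> WW X x y ^ 2 = disc X x y.
Proof. intros HS Hxy. apply pow2_sqrt, Rlt_le, HS, Hxy. Qed.

(** In [d], [n] stands for the derivative of the numerator, [n'] for the numerator itself and [D']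
    for the derivative of [disc]. *)
Lemma fff_quot_derive M X x y : open M -> (forall i, Ck 2 M (X i)) -> spacelike_on M X -> M (x, y) ->
  let d n n' D' := (n * disc X x y - n' * (D' / 2)) / WW X x y ^ 3 in
  is_derive (fun t => EE X x t / WW X x t) y
    (d (2 * lor (Xxy X x y) (Xx X x y)) (EE X x y) (disc_y X x y)) /\
  is_derive (fun t => FF X t y / WW X t y) x
    (d (lor (Xxx X x y) (Xy X x y) + lor (Xxy X x y) (Xx X x y)) (FF X x y) (disc_x X x y)) /\
  is_derive (fun t => FF X x t / WW X x t) y
    (d (lor (Xxy X x y) (Xy X x y) + lor (Xyy X x y) (Xx X x y)) (FF X x y) (disc_y X x y)) /\
  is_derive (fun t => GG X t y / WW X t y) x
    (d (2 * lor (Xxy X x y) (Xy X x y)) (GG X x y) (disc_x X x y)).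
Proof.
  intros HO HX HS Hxy d. destruct (HS x y Hxy) as [_ HD].
  destruct (fff_derive M X x y HO HX Hxy) as [[Ex Ey] [[Fx Fy] [Gx Gy]]].
  pose proof (is_derive_disc _ _ _ _ _ _ _ Ex Gx Fx) as Dx.
  pose proof (is_derive_disc _ _ _ _ _ _ _ Ey Gy Fy) as Dy.
  exact (conj (is_derive_div_sqrt _ _ _ _ _ Ey Dy HD) (conj (is_derive_div_sqrt _ _ _ _ _ Fx Dx HD)
    (conj (is_derive_div_sqrt _ _ _ _ _ Fy Dy HD) (is_derive_div_sqrt _ _ _ _ _ Gx Dx HD)))).
Qed.

Lemma lor_curv_trace X x y V : lor (curv_trace X x y) V =
  GG X x y * lor (Xxx X x y) V - 2 * FF X x y * lor (Xxy X x y) V + EE X x y * lor (Xyy X x y) V.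
Proof. unfold curv_trace, lor; ring. Qed.

(* Multiplied by W^3, the curl of (E/W, F/W) is E <N,X_y> - F <N,X_x>,
   and the curl of (F/W, G/W) is F <N,X_y> - G <N,X_x>. *)
Lemma minimal_closed_forms M X : open M -> (forall i, Ck 2 M (X i)) -> spacelike_on M X ->
  (forall x y, M (x, y) ->
    lor (curv_trace X x y) (Xx X x y) = 0 /\ lor (curv_trace X x y) (Xy X x y) = 0) ->
  closed_form M (fun x y => EE X x y / WW X x y) (fun x y => FF X x y / WW X x y) /\
  closed_form M (fun x y => FF X x y / WW X x y) (fun x y => GG X x y / WW X x y).
Proof.
  intros HO HX HS HN.
  assert (Conv : forall (h : R -> R) (s a b : R), is_derive h s a -> a = b -> is_derive h s b)
    by (intros; subst; assumption).
  assert (HW : forall p, M p -> WW X (fst p) (snd p) <> 0)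
    by (intros [x y] Hp; apply Rgt_not_eq, (WW_pos M); assumption).
  assert (HC : forall p, M p ->
    continuous (unc (fun x y => EE X x y / WW X x y)) p /\
    continuous (unc (fun x y => FF X x y / WW X x y)) p /\
    continuous (unc (fun x y => GG X x y / WW X x y)) p).
  { intros p Hp. destruct (continuous_fff M X p HX Hp) as [CE [CF [CG _]]].
    pose proof (continuous_WW M X p HX Hp) as CW. pose proof (HW p Hp).
    refine (conj _ (conj _ _)); apply continuous_Rdiv; assumption. }
  assert (CK : forall p n n', M p ->
    continuous (unc n) p -> continuous (unc n') p ->
    continuous (unc (fun x y => (n x y * disc X x y - n' x y * (disc_y X x y / 2)) / WW X x y ^ 3)) p).
  { intros p n n' Hp Cn Cn'. destruct (continuous_fff M X p HX Hp) as [CE [CF [CG [CD _]]]].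
    apply continuous_Rdiv; [|apply continuous_Rpow, (continuous_WW M); assumption|
      apply pow_nonzero, HW, Hp].
    apply continuous_Rminus; apply continuous_Rmult; try assumption.
    - apply continuous_Rminus; [apply continuous_Rmult|apply continuous_Rpow]; assumption.
    - apply continuous_Rdiv; [assumption|apply continuous_const|apply Rgt_not_eq, Rlt_0_2]. }
  split; split; try (intros p Hp; destruct (HC p Hp) as [? [? ?]]; split; assumption).
  (* The witness is the y-derivative of E/W, found by unification in the continuity goal. *)
  - eexists. split.
    + intros p Hp. destruct (continuous_fff M X p HX Hp) as [CE [CF [CG [CD [L1 [L2 L3]]]]]].
      apply (CK p (fun x y => 2 * lor (Xxy X x y) (Xx X x y)) (EE X)); auto.
      apply continuous_Rmult; [apply continuous_const|assumption].
    + intros x y Hxy. destruct (fff_quot_derive M X x y HO HX HS Hxy) as [D1 [D2 _]].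
      split; [exact D1|]. apply (Conv _ _ _ _ D2). f_equal. destruct (HN x y Hxy) as [Ha Hb].
      rewrite lor_curv_trace in Ha, Hb. apply Rminus_diag_uniq.
      (* The zeros are placeholders: they are rewritten backwards into <N,X_y> and <N,X_x>, which
         exposes the curl identity to [field]. *)
      transitivity (EE X x y * 0 - FF X x y * 0); [|ring].
      rewrite <- Ha at 2. rewrite <- Hb. unfold disc, disc_x, disc_y. field.
  - eexists. split.
    + intros p Hp. destruct (continuous_fff M X p HX Hp) as [CE [CF [CG [CD [L1 [L2 L3]]]]]].
      apply (CK p (fun x y => lor (Xxy X x y) (Xy X x y) + lor (Xyy X x y) (Xx X x y)) (FF X)); auto.
      apply continuous_Rplus; assumption.
    + intros x y Hxy. destruct (fff_quot_derive M X x y HO HX HS Hxy) as [_ [_ [D1 D2]]].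
      split; [exact D1|]. apply (Conv _ _ _ _ D2). f_equal. destruct (HN x y Hxy) as [Ha Hb].
      rewrite lor_curv_trace in Ha, Hb. apply Rminus_diag_uniq.
      transitivity (FF X x y * 0 - GG X x y * 0); [|ring].
      rewrite <- Ha at 2. rewrite <- Hb. unfold disc, disc_x, disc_y. field.
Qed.

(** * Isothermic parameters *)

(** Substituting EG = W^2 + F^2 gives u_x^2 + v_x^2 = E (2W + E + G) / W^2, and the same factor
    multiplies F and G in the other two products. The Jacobian is (2W + E + G) / W, which is
    positive. *)
Lemma isothermic_algebra E F G W : 0 < E -> 0 < W -> W ^ 2 = E * G - F ^ 2 ->
  let ux := 1 + E / W in let uy := F / W in let vx := F / W in let vy := 1 + G / W in
  (uy = F / E * ux - W / E * vx /\ vy = W / E * ux + F / E * vx) /\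
  ux * vy - uy * vx <> 0 /\
  exists lam, 0 < lam /\ E = lam ^ 2 * (ux ^ 2 + vx ^ 2) /\
    F = lam ^ 2 * (ux * uy + vx * vy) /\ G = lam ^ 2 * (uy ^ 2 + vy ^ 2).
Proof.
  intros HE HW Hsq ux uy vx vy.
  assert (HG : G = (W ^ 2 + F ^ 2) / E) by (rewrite Hsq; field; lra).
  assert (HGpos : 0 < G).
  { rewrite HG. apply Rdiv_lt_0_compat; [|assumption]. pose proof (pow_lt W 2 HW).
    pose proof (pow2_ge_0 F). lra. }
  assert (HS : 0 < 2 * W + E + G) by lra.
  assert (HJ : ux * vy - uy * vx = (2 * W + E + G) / W).
  { unfold ux, uy, vx, vy. rewrite HG. field; lra. }
  split; [split|split].
  - unfold uy, ux, vx. field; lra.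
  - unfold vy, ux, vx. rewrite HG. field; lra.
  - rewrite HJ. apply Rgt_not_eq, Rdiv_lt_0_compat; assumption.
  - assert (Hq : 0 < W ^ 2 / (2 * W + E + G)).
    { apply Rdiv_lt_0_compat; [apply pow_lt|]; assumption. }
    exists (sqrt (W ^ 2 / (2 * W + E + G))). split; [apply sqrt_lt_R0, Hq|].
    rewrite pow2_sqrt by lra. rewrite HG in HS. unfold ux, uy, vx, vy. rewrite HG.
    (* This is E (2W + E + G) after elimination of G, the denominator that [field] meets. *)
    assert (HS' : 2 * W * E + E * E + W ^ 2 + F ^ 2 <> 0).
    { replace (2 * W * E + E * E + W ^ 2 + F ^ 2) with (E * (2 * W + E + (W ^ 2 + F ^ 2) / E))
        by (field; lra). apply Rgt_not_eq, Rmult_lt_0_compat; assumption. }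
    repeat split; field; repeat split; try lra; intros H0; apply HS'; rewrite <- H0; ring.
Qed.

(** The tangential argument sees the type of the graph only through the positions of x and y among
    the components. *)
Lemma graph_coordinates (b : bool) A B : let X := if b then graph1 A B else graph2 A B in
  exists ix iy, (ix < 4)%nat /\ (iy < 4)%nat /\ X ix = (fun x _ => x) /\ X iy = (fun _ y => y).
Proof.
  destruct b; [exists 1%nat, 2%nat|exists 0%nat, 3%nat]; repeat split; lia.
Qed.

Lemma graph_Ck k U (b : bool) A B i : Ck k U A -> Ck k U B ->
  Ck k U ((if b then graph1 A B else graph2 A B) i).
Proof.
  intros HA HB. destruct b, i as [|[|[|i]]]; auto using Ck_fst, Ck_snd.
Qed.

(** The path integrals are expressed by their gradients and the values at the base point; on a
    connected open set these data determine [u] and [v]. *)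
Theorem theorem5p9 (M : R * R -> Prop) (A B : R -> R -> R) (first_type : bool)
  (x0 y0 : R) :
  open_R2 M -> connected_set M -> simply_connected M ->
  smooth_on M A -> smooth_on M B ->
  let X := if first_type then graph1 A B else graph2 A B in
  spacelike_on M X -> minimal_on M X -> M (x0, y0) ->
  exists u v : R -> R -> R,
    u x0 y0 = x0 /\ v x0 y0 = y0 /\
    (forall x y, M (x, y) ->
       ex_derive (fun t => u t y) x /\ ex_derive (fun t => u x t) y /\
       ex_derive (fun t => v t y) x /\ ex_derive (fun t => v x t) y /\
       px u x y = 1 + EE X x y / WW X x y /\
       py u x y = FF X x y / WW X x y /\
       px v x y = FF X x y / WW X x y /\
       py v x y = 1 + GG X x y / WW X x y) /\
    (forall x y, M (x, y) ->
       py u x y = FF X x y / EE X x y * px u x y - WW X x y / EE X x y * px v x y /\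
       py v x y = WW X x y / EE X x y * px u x y + FF X x y / EE X x y * px v x y) /\
    (forall x y, M (x, y) ->
       px u x y * py v x y - py u x y * px v x y <> 0 /\
       exists lam : R, 0 < lam /\
         EE X x y = lam ^ 2 * (px u x y ^ 2 + px v x y ^ 2) /\
         FF X x y = lam ^ 2 * (px u x y * py u x y + px v x y * py v x y) /\
         GG X x y = lam ^ 2 * (py u x y ^ 2 + py v x y ^ 2)).
Proof.
  intros HO HCon HSC HA HB X HS HMin H0.
  assert (HX : forall i, Ck 2 M (X i)) by (intros i; apply graph_Ck; [apply HA|apply HB]).
  destruct (graph_coordinates first_type A B) as [ix [iy [Hix [Hiy [Ex Ey]]]]]. fold X in Ex, Ey.
  destruct (minimal_closed_forms M X HO HX HS) as [HC1 HC2].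
  { intros x y Hxy. apply (minimal_graph_tangential M X ix iy); assumption. }
  destruct (closed_form_exact _ _ _ x0 y0 HO HCon HSC HC1 H0) as [f [f0 Df]].
  destruct (closed_form_exact _ _ _ x0 y0 HO HCon HSC HC2 H0) as [g [g0 Dg]].
  (* The potentials vanish at the base point, so these sums take the values x0 and y0 there. *)
  exists (fun x y => x + f x y), (fun x y => y + g x y).
  assert (Dplus : forall (h : R -> R) (c s l : R), is_derive h s l -> is_derive (fun t => c + h t) s l).
  { intros h c s l Hl. replace l with (0 + l) by ring. apply is_derive_Rplus; [|assumption].
    apply (is_derive_const (K := R_AbsRing) (V := R_NormedModule)). }
  assert (Did : forall (h : R -> R) (s l : R), is_derive h s l -> is_derive (fun t => t + h t) s (1 + l)).
  { intros h s l Hl. apply is_derive_Rplus; [|assumption]. apply (is_derive_id (K := R_AbsRing)). }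
  assert (D : forall x y, M (x, y) ->
    (is_derive (fun t => t + f t y) x (1 + EE X x y / WW X x y) /\
     is_derive (fun t => x + f x t) y (FF X x y / WW X x y)) /\
    (is_derive (fun t => y + g t y) x (FF X x y / WW X x y) /\
     is_derive (fun t => t + g x t) y (1 + GG X x y / WW X x y))).
  { intros x y Hxy. destruct (Df x y Hxy) as [F1 F2], (Dg x y Hxy) as [G1 G2].
    exact (conj (conj (Did _ _ _ F1) (Dplus _ _ _ _ F2)) (conj (Dplus _ _ _ _ G1) (Did _ _ _ G2))). }
  split; [rewrite f0; ring|]. split; [rewrite g0; ring|].
  assert (P : forall x y, M (x, y) ->
    px (fun x y => x + f x y) x y = 1 + EE X x y / WW X x y /\
    py (fun x y => x + f x y) x y = FF X x y / WW X x y /\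
    px (fun x y => y + g x y) x y = FF X x y / WW X x y /\
    py (fun x y => y + g x y) x y = 1 + GG X x y / WW X x y).
  { intros x y Hxy. destruct (D x y Hxy) as [[D1 D2] [D3 D4]].
    exact (conj (is_derive_unique _ _ _ D1) (conj (is_derive_unique _ _ _ D2)
      (conj (is_derive_unique _ _ _ D3) (is_derive_unique _ _ _ D4)))). }
  split; [|split]; intros x y Hxy.
  - destruct (D x y Hxy) as [[D1 D2] [D3 D4]].
    exact (conj (ex_intro _ _ D1) (conj (ex_intro _ _ D2)
      (conj (ex_intro _ _ D3) (conj (ex_intro _ _ D4) (P x y Hxy))))).
  - destruct (P x y Hxy) as [-> [-> [-> ->]]].
    apply isothermic_algebra; [apply HS, Hxy|apply (WW_pos M)|apply (WW_sqr M)]; assumption.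
  - destruct (P x y Hxy) as [-> [-> [-> ->]]].
    apply isothermic_algebra; [apply HS, Hxy|apply (WW_pos M)|apply (WW_sqr M)]; assumption.
Qed.
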